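(* Let $\mathcal{A}$ be an essential central arrangement of $d$ hyperplanes of rank $n$ in $\mathbb{C}^n$, and let $I_2\subseteq R=\mathbb{C}[y_1,\dots,y_d]$ be the ideal generated by the quadratic elements of its Orlik-Terao ideal. If $\operatorname{codim}(I_2)=d-n$, then $\mathcal{A}$ is 2-formal.
   Context: Arrangement: $\mathcal{A}=\{H_1,\dots,H_d\}$ is a set of $d$ distinct hyperplanes through the origin in $\mathbb{C}^n$, $H_i=V(\alpha_i)$ with $\alpha_i\in\mathbb{C}[x_1,\dots,x_n]_1$ nonzero linear forms (fixed once and for all; pairwise non-proportional). $\mathcal{A}$ is essential, i.e. $\bigcap_i H_i=\{0\}$, equivalently $\alpha_1,\dots,\alpha_d$ span an $n$-dimensional space (rank $n$). Orlik-Terao ideal: let $R=\mathbb{C}[y_1,\dots,y_d]$. For each $\Lambda=\{i_1,\dots,i_k\}\subseteq\{1,\dots,d\}$ with $\operatorname{codim}\bigcap_{j}H_{i_j}<k$ and each nontrivial linear dependency $\sum_{j=1}^k c_{i_j}\alpha_{i_j}=0$, put $r_\Lambda=\sum_{j}c_{i_j}y_{i_j}$ and $f_\Lambda=\partial(r_\Lambda)=\sum_{j=1}^k c_{i_j}\,(y_{i_1}\cdots\widehat{y_{i_j}}\cdots y_{i_k})$. The ideal $I\subseteq R$ generated by all the $f_\Lambda$ is the Orlik-Terao ideal of $\mathcal{A}$. $I_2$ denotes the ideal of $R$ generated by the degree-two elements of $I$. The codimension of an ideal of $R$ is its height. 2-formality: the relation space $F(\mathcal{A})$ is the kernel of the linear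 map $\bigoplus_{i=1}^d\mathbb{C}e_i\to\mathbb{C}[x_1,\dots,x_n]_1$, $e_i\mapsto\alpha_i$. $\mathcal{A}$ is 2-formal if $F(\mathcal{A})$ is spanned by relations involving only three hyperplanes (three nonzero coefficients). *)

(* Defs.v *)
From HB Require Import structures.
From mathcomp Require Import all_boot all_order all_algebra.
From mathcomp Require Import ring_quotient complex mpoly.
From mathcomp Require Import boolp classical_sets reals.

Set Implicit Arguments.
Unset Strict Implicit.
Unset Printing Implicit Defensive.

Import GRing.Theory.
Local Open Scope ring_scope.

Section Ideals.
Variable A : comNzRingType.
Implicit Types I P : set A.

Definition ideal_generated (S : set A) : set A :=
  [set p | exists s : seq (A * A),
     (forall u, u \in s -> S u.2) /\ p = \sum_(u <- s) u.1 * u.2]%classic.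

(* [idealr_closed] already requires 1 \notin P *)
Definition prime_ideal P : Prop :=
  idealr_closed (mem P) /\ prime_idealr_closed (mem P).

(* a chain P_0 < P_1 < ... < P_k = P, of length k *)
Definition prime_chain P (k : nat) : Prop :=
  exists Q : nat -> set A,
    [/\ forall i, (i <= k)%N -> prime_ideal (Q i),
        forall i, (i < k)%N -> (Q i `<` Q i.+1)%classic
      & Q k = P].

Definition prime_has_height P (h : nat) : Prop :=
  prime_chain P h /\ (forall k, prime_chain P k -> (k <= h)%N).

(* The height of an ideal is the minimum of the heights of the primes
   containing it; a prime has height >= h iff some chain of length h ends
   in it.  No h is a height of the unit ideal. *)
Definition has_height I (h : nat) : Prop :=
  (exists P, [/\ prime_ideal P, (I `<=` P)%classic & prime_has_height P h])
  /\ (forall P, prime_ideal P -> (I `<=` P)%classic -> prime_chain P h).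

End Ideals.

Section Arrangements.
Variables (K : fieldType) (n d : nat).

(* C[x_1, ..., x_n]_1 is represented as the dual of the space of columns *)
Definition linear_form := 'Hom('cV[K]_n, K^o).

Variable alpha : 'I_d -> linear_form.

Definition hyperplane (i : 'I_d) : {vspace 'cV[K]_n} := lker (alpha i).

Definition flat (L : {set 'I_d}) : {vspace 'cV[K]_n} :=
  (\bigcap_(i in L) hyperplane i)%VS.

Definition codim_flat (L : {set 'I_d}) : nat := (n - \dim (flat L))%N.

Definition arrangement : Prop :=
  (forall i, alpha i != 0) /\ injective hyperplane.

Definition essential : Prop := flat [set: 'I_d]%SET = 0%VS.

Definition relation_map (c : 'rV[K]_d) : linear_form :=
  \sum_(i < d) c 0 i *: alpha i.

Fact relation_map_is_linear : linear relation_map.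
Proof.
move=> a u v; rewrite /relation_map scaler_sumr -big_split /=.
by apply: eq_bigr => i _; rewrite !mxE scalerDl scalerA.
Qed.

HB.instance Definition _ :=
  GRing.isLinear.Build K 'rV[K]_d linear_form _ relation_map
    relation_map_is_linear.

Definition relation_space : {vspace 'rV[K]_d} := lker (linfun relation_map).

Definition weight (c : 'rV[K]_d) : nat := #|[pred i | c 0 i != 0]|.

Definition two_formal : Prop :=
  exists s : seq 'rV[K]_d,
    (forall c, c \in s -> c \in relation_space /\ weight c = 3%N)
    /\ <<s>>%VS = relation_space.

(* Coefficients c_i with i in L may vanish, but not all of them *)
Definition dependency (L : {set 'I_d}) (c : 'I_d -> K) : Prop :=
  \sum_(i in L) c i *: alpha i = 0 /\ (exists2 i, i \in L & c i != 0).

Definition OT_generator (L : {set 'I_d}) (c : 'I_d -> K) : {mpoly K[d]} :=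
  \sum_(i in L) c i *: \prod_(j in L :\ i) 'X_j.

Definition OT_ideal : set {mpoly K[d]} :=
  ideal_generated [set f | exists (L : {set 'I_d}) (c : 'I_d -> K),
    [/\ (codim_flat L < #|L|)%N, dependency L c & f = OT_generator L c]]%classic.

Definition OT_quadratic_ideal : set {mpoly K[d]} :=
  ideal_generated [set f | OT_ideal f /\ f \is 2.-homog]%classic.

End Arrangements.

(* Main.v *)
Require Import Defs.
From HB Require Import structures.
From mathcomp Require Import all_boot all_order all_algebra.
From mathcomp Require Import ring_quotient complex mpoly.
From mathcomp Require Import boolp classical_sets reals.

(** Let [G] be the span of the weight-three relations, inside the relation space
    [F], which has dimension [d - n].  A quadratic element of the Orlik-Terao ideal
    is a combination of the [f_L] with [#|L| = 3], and on the torus [f_L] vanishes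
    at [y] exactly when its relation vanishes at [1 / y].  On the torus the zero
    locus of [I_2] is therefore the coordinatewise inverse of the linear space
    orthogonal to [G].  This locus is nonempty: no coordinate vanishes identically
    on that linear space, which contains the vectors of values
    [(alpha_1 v, ..., alpha_d v)].  Its closure is an irreducible variety of
    codimension [dim G], and its ideal is a prime that contains [I_2].  If the
    height of [I_2] is [d - n], this prime has height at least [d - n]; hence
    [dim G >= d - n = dim F] and [G = F].

    The prime is realised as the kernel of the comorphism [cremona] of a
    parametrisation of the inverted linear space; [OT_quadratic_ideal_cremona]
    shows that it contains [I_2].

    The bound on its height is [prime_chain_bound], an elementary form of the
    inequality between height and transcendence degree.  Given a chain of primes
    ending in [P] and elements independent modulo [P], each step down the chain
    provides one more independent element ([independent_mod_cons]), while more than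
    [d] polynomials in [d] variables are always dependent
    ([independent_mod_size]).  Here the coordinates that parametrise the linear
    space are independent modulo [P] ([cremona_independent]). *)

Set Implicit Arguments.
Unset Strict Implicit.
Unset Printing Implicit Defensive.

Import GRing.Theory.
Local Open Scope ring_scope.

(** * Heights and algebraic independence *)

Lemma prime_idealP (A : comNzRingType) (P : set A) : prime_ideal P ->
  [/\ P 0, ~ P 1, forall a u v, P u -> P v -> P (a * u + v)
    & forall u v, P (u * v) -> P u \/ P v].
Proof.
case=> -[P0 P1 Plin] Pprime; split.
- by rewrite -[P 0]in_setE.
- by move=> H; move: P1; rewrite -[_ \notin _]/(~~ (1 \in P)) mem_set.
- move=> a u v Pu Pv; rewrite -[P _]in_setE.
  by apply: Plin; apply: mem_set.
- move=> u v Puv; have /orP[] := Pprime u v (mem_set Puv) => H.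
    by left; rewrite -[P _]in_setE.
  by right; rewrite -[P _]in_setE.
Qed.

Section BoxSum.
Variables (K : nzRingType) (A : comNzRingType) (cst : {rmorphism K -> A}).

(** Evaluation at [xs] of a polynomial whose exponents are all smaller than
    [N].  Exponent vectors are plain lists, so that passing from [x :: xs] to
    [xs] only restricts [c] to the lists that start with a fixed exponent. *)
Fixpoint box_sum (N : nat) (xs : seq A) (c : seq nat -> K) : A :=
  if xs is x :: xs' then
    \sum_(i < N) x ^+ i * box_sum N xs' (fun e => c (val i :: e))
  else cst (c [::]).

Definition nontrivial (N k : nat) (c : seq nat -> K) : Prop :=
  exists e, [/\ size e = k, all (gtn N) e & c e != 0].

(** For prime [P] this is algebraic independence over [K] of the classes of
    [xs] in the quotient by [P]. *)
Definition independent_mod (P : set A) (xs : seq A) : Prop :=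
  forall N c, nontrivial N (size xs) c -> ~ P (box_sum N xs c).

(** The polynomial [\sum_i b_i X^i] at [x] is congruent to [b_0] modulo [x], so
    its value can lie in [Q] only if [b_0] lies in [Q'], hence only if [b_0 = 0];
    then a factor [x], which [Q] does not contain, can be cancelled. *)
Lemma coefs_in_larger_prime (Q Q' : set A) (x : A) (N : nat) (b : nat -> A) :
    prime_ideal Q -> prime_ideal Q' -> (Q `<=` Q')%classic -> Q' x -> ~ Q x ->
    (forall i, (i < N)%N -> Q' (b i) -> b i = 0) ->
  Q (\sum_(i < N) x ^+ i * b i) -> forall i, (i < N)%N -> Q' (b i).
Proof.
move=> /prime_idealP[_ _ _ primeQ] /prime_idealP[Q'0 _ linQ' _] sQ Q'x nQx.
elim: N b => [|N IH] b b0 //; rewrite big_ord_recl expr0 mul1r => Qs.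
have tailE : \sum_(i < N) x ^+ bump 0 i * b (bump 0 i)
    = x * \sum_(i < N) x ^+ i * b i.+1.
  by rewrite mulr_sumr; apply: eq_bigr => i _; rewrite exprS mulrA.
rewrite tailE in Qs.
have Q'b0 : Q' (b 0%N).
  have /= := linQ' (- (\sum_(i < N) x ^+ i * b i.+1)) _ _ Q'x (sQ _ Qs).
  by rewrite [- _ * x]mulNr [_ * x]mulrC addrC addrK.
case=> [|i] lt_i //; apply: (IH (fun i => b i.+1)) => // [j ltj|].
  exact: b0.
move: Qs; rewrite (b0 0%N) ?add0r // => /primeQ [] //.
Qed.

Lemma box_sum0 N xs (c : seq nat -> K) :
  ~ nontrivial N (size xs) c -> box_sum N xs c = 0.
Proof.
elim: xs c => [|x xs IH] c ntc /=.
  have [->|nz] := eqVneq (c [::]) 0; first exact: rmorph0.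
  by case: ntc; exists [::].
rewrite big1 // => i _; rewrite IH ?mulr0 // => -[e [sz_e lt_e nz_e]].
by apply: ntc; exists (val i :: e); rewrite /= sz_e ltn_ord.
Qed.

(** The transcendence degree of the quotient drops strictly from [Q] to a
    larger prime [Q'], in the effective form of Coquand and Lombardi: an element
    of the difference can be added to every family independent modulo [Q']. *)
Lemma independent_mod_cons (Q Q' : set A) (x : A) (xs : seq A) :
    prime_ideal Q -> prime_ideal Q' -> (Q `<=` Q')%classic -> Q' x -> ~ Q x ->
  independent_mod Q' xs -> independent_mod Q (x :: xs).
Proof.
move=> prQ prQ' sQ Q'x nQx ind N c [[|i e] [//= [sz_e]]] /andP[lt_i lt_e] nz Qs.
pose b j := box_sum N xs (fun e => c (j :: e)).
apply: (ind N (fun e => c (i :: e))); first by exists e.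
refine (@coefs_in_larger_prime Q Q' x N b prQ prQ' sQ Q'x nQx _ Qs i lt_i).
by move=> j _ Q'b; apply: box_sum0 => ntc; apply: ind ntc Q'b.
Qed.

Lemma independent_mod_chain (P : set A) (k : nat) (us : seq A) :
    prime_chain P k -> independent_mod P us ->
  exists Q xs, [/\ prime_ideal Q, size xs = (k + size us)%N
                 & independent_mod Q xs].
Proof.
case=> Q [prQ ltQ QkP]; rewrite -{}QkP.
elim: k us prQ ltQ => [|k IH] us prQ ltQ ind.
  by exists (Q 0%N), us; split=> //; apply: prQ.
have [sQ [x [Qx nQx]]] : (Q k `<=` Q k.+1)%classic
    /\ exists x, Q k.+1 x /\ ~ Q k x.
  have [sQ nsQ] := ltQ k (ltnSn k); split=> //; apply: contrapT => nex.
  by apply: nsQ => x Qx; apply: contrapT => nQx; apply: nex; exists x.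
rewrite addSnnS; apply: (IH (x :: us)).
- by move=> i lei; apply: prQ; apply: leqW.
- by move=> i lti; apply: ltQ; apply: leqW.
by apply: (independent_mod_cons _ _ sQ Qx nQx ind); apply: prQ.
Qed.

Lemma box_sum_linear N xs a (c c' : seq nat -> K) :
  box_sum N xs (fun e => a * c e + c' e)
    = cst a * box_sum N xs c + box_sum N xs c'.
Proof.
elim: xs c c' => [|x xs IH] c c' /=; first by rewrite rmorphD rmorphM.
rewrite mulr_sumr -big_split /=; apply: eq_bigr => i _.
by rewrite IH mulrDr mulrCA.
Qed.

End BoxSum.

Lemma box_sum_map (K : nzRingType) (A B : comNzRingType)
    (cst : {rmorphism K -> A}) (phi : {rmorphism A -> B})
    (cst' : {rmorphism K -> B}) N xs c :
    phi \o cst =1 cst' ->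
  phi (box_sum cst N xs c) = box_sum cst' N (map phi xs) c.
Proof.
move=> phiE; elim: xs c => [|x xs IH] c /=; first exact: phiE.
by rewrite rmorph_sum; apply: eq_bigr => i _; rewrite rmorphM rmorphXn IH.
Qed.

Section Dependence.
Variables (K : fieldType) (d : nat).
Local Notation A := {mpoly K[d]}.
Local Notation cst := (@mpolyC d K).

Lemma msize_mul_leq (p q : A) a b :
  (msize p <= a.+1 -> msize q <= b.+1 -> msize (p * q) <= (a + b).+1)%N.
Proof.
move=> ha hb; have [->|nzp] := eqVneq p 0; first by rewrite mul0r msize0.
have [->|nzq] := eqVneq q 0; first by rewrite mulr0 msize0.
rewrite msizeM // -subn1 leq_subLR add1n -addSn -addnS.
exact: leq_add.
Qed.

Lemma msize_exp_leq (p : A) a i :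
  (msize p <= a.+1 -> msize (p ^+ i) <= (i * a).+1)%N.
Proof.
move=> ha; elim: i => [|i IH]; first by rewrite expr0 msize1.
by rewrite exprS mulSn msize_mul_leq.
Qed.

(** Evaluating a polynomial of the box raises degrees at most linearly in [N];
    this linear growth is what the dimension count needs. *)
Lemma msize_box_sum N D (xs : seq A) c :
    (forall x, x \in xs -> msize x <= D.+1)%N ->
  (msize (box_sum cst N xs c) <= (size xs * (N * D)).+1)%N.
Proof.
elim: xs c => [|x xs IH] c leD /=; first by rewrite msizeC leq_b1.
apply: leq_trans (msize_sum _ _ _) _; apply/bigmax_leqP => i _.
rewrite mulSn msize_mul_leq //.
  apply: leq_trans (msize_exp_leq i (leD x _)) _; first exact: mem_head.
  by rewrite ltnS leq_mul2r ltnW ?orbT.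
by apply: IH => y xs_y; apply: leD; rewrite inE xs_y orbT.
Qed.

Section BoxMatrix.
Variables (N M : nat) (xs : seq A).
Local Notation T := ((size xs).-tuple 'I_N).
Local Notation B := (d.-tuple 'I_M).

Definition box_coef (v : 'rV[K]_#|{: T}|) (e : seq nat) : K :=
  \sum_(t : T | map val t == e) v 0 (enum_rank t).

Definition box_row (v : 'rV[K]_#|{: T}|) : 'rV[K]_#|{: B}| :=
  \row_b (box_sum cst N xs (box_coef v))
           @_[multinom val (tnth (enum_val b) i) | i < d].

Fact box_row_is_linear : linear box_row.
Proof.
move=> a u v; apply/rowP => b; rewrite !mxE -mcoeffZ -mul_mpolyC.
rewrite -mcoeffD -box_sum_linear; congr (box_sum _ _ _ _)@__.
apply: funext => e; rewrite /box_coef mulr_sumr -big_split /=.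
by apply: eq_bigr => t _; rewrite !mxE.
Qed.

HB.instance Definition _ :=
  GRing.isLinear.Build K _ _ _ box_row box_row_is_linear.

(** More monomials in the box than monomials available for the values: the
    evaluation map then has a kernel. *)
Lemma box_relation :
    (M ^ d < N ^ size xs)%N -> (forall c, msize (box_sum cst N xs c) <= M)%N ->
  exists2 c, nontrivial N (size xs) c & box_sum cst N xs c = 0.
Proof.
move=> ltMN leM.
have : kermx (lin1_mx box_row) != 0.
  rewrite kermx_eq0 /row_free neq_ltn; apply/orP; left.
  by apply: leq_ltn_trans (rank_leq_col _) _; rewrite !card_tuple !card_ord.
case/rowV0Pn => v /sub_kermxP; rewrite mul_rV_lin1 /= => v0 nzv.
exists (box_coef v).
  have [j nzj] : exists j, v 0 j != 0.
    apply/existsP; apply: contraR nzv; rewrite negb_exists => /forallP v0'.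
    by apply/eqP/rowP => j; rewrite mxE; apply/eqP; rewrite -[_ == _]negbK.
  exists (map val (enum_val j : T)); split.
  - by rewrite size_map size_tuple.
  - by apply/allP => _ /mapP[i _ ->] /=.
  rewrite /box_coef (big_pred1 (enum_val j)) ?enum_valK // => t /=.
  by rewrite (inj_eq (inj_map val_inj)).
apply/mpolyP => m; rewrite mcoeff0.
have [lt_m|/forallPn] := boolP [forall i : 'I_d, (m i < M)%N]; last first.
  case=> i; rewrite -leqNgt => leMm.
  apply/memN_msupp_eq0/msize_mdeg_ge/(leq_trans (leM _))/(leq_trans leMm).
  by rewrite mdegE (bigD1 i) //= leq_addr.
pose t : B := [tuple Ordinal (fintype.forallP lt_m i) | i < d].
have := congr1 (fun r : 'rV__ => r 0 (enum_rank t)) v0; rewrite !mxE enum_rankK.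
by congr (_@__ = _); apply/mnmP => i; rewrite mnmE tnth_mktuple.
Qed.

End BoxMatrix.

(** In [d] variables more than [d] polynomials are dependent: evaluation sends a
    space of dimension [N ^ size xs] into one of dimension [O(N ^ d)]. *)
Lemma independent_mod_size (P : set A) (xs : seq A) :
  P 0 -> independent_mod cst P xs -> (size xs <= d)%N.
Proof.
move=> P0 ind; rewrite leqNgt; apply/negP => lt_d.
pose D := (\max_(x <- xs) msize x)%N.
have leD x : x \in xs -> (msize x <= D.+1)%N.
  by move=> xs_x; apply/leqW; apply: leq_bigmax_seq.
(* All values have degree less than N * C, and N is chosen large enough for
   (N * C) ^ d < N ^ d.+1. *)
pose C := ((size xs * D).+1)%N; pose N := (C ^ d).+1.
have [|c|c nt0 c0] := @box_relation N (size xs * (N * D)).+1 xs.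
- have leC : ((size xs * (N * D)).+1 <= N * C)%N.
    by rewrite mulnCA mulnS -add1n leq_add2r.
  have leX a b e : (a <= b -> a ^ e <= b ^ e)%N.
    by case: e => // e ?; rewrite leq_exp2r.
  apply: (@leq_ltn_trans ((N * C) ^ d)); first exact: leX.
  apply: (@leq_trans (N ^ d.+1)); last by rewrite leq_pexp2l.
  by rewrite expnMn expnSr ltn_pmul2l ?expn_gt0.
- exact: msize_box_sum.
by apply: (ind N c nt0); rewrite c0.
Qed.

(** Height plus transcendence degree of the quotient is at most [d]. *)
Lemma prime_chain_bound (P : set A) (k : nat) (us : seq A) :
  prime_chain P k -> independent_mod cst P us -> (k + size us <= d)%N.
Proof.
move=> chP ind; have [Q [xs [prQ <- indQ]]] := independent_mod_chain chP ind.
by have [Q0 _ _ _] := prime_idealP prQ; apply: independent_mod_size Q0 indQ.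
Qed.

End Dependence.

(** * The prime of a linear space under coordinatewise inversion *)

Section Kernels.
Variables (A : comNzRingType) (B : idomainType) (phi : {rmorphism A -> B}).

Definition kernel : set A := [set p | phi p = 0]%classic.

Lemma kernel_prime : prime_ideal kernel.
Proof.
split; [split|].
- by apply: mem_set; apply: rmorph0.
- apply/negP; rewrite in_setE /kernel /= rmorph1.
  by apply/eqP; apply: oner_neq0.
- move=> a u v; rewrite !in_setE /kernel /= => u0 v0.
  by rewrite rmorphD rmorphM u0 v0 mulr0 addr0.
- move=> u v; rewrite in_setE /kernel /= rmorphM => /eqP.
  by rewrite mulf_eq0 => /orP[] /eqP H; apply/orP; [left|right]; apply: mem_set.
Qed.

End Kernels.

Lemma mmap_comp (n : nat) (K A B : comNzRingType) (f : {rmorphism K -> A})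
    (g : {rmorphism A -> B}) (h : 'I_n -> A) (f' : {rmorphism K -> B})
    (h' : 'I_n -> B) :
    g \o f =1 f' -> g \o h =1 h' ->
  forall p, g (mmap f h p) = mmap f' h' p.
Proof.
move=> fE hE p; rewrite /mmap rmorph_sum; apply: eq_bigr => m _.
rewrite rmorphM /= -fE /mmap1 rmorph_prod; congr (_ * _).
by apply: eq_bigr => i _; rewrite rmorphXn -hE.
Qed.

Lemma mmap_var (n : nat) (K A : nzRingType) (f : {rmorphism K -> A})
    (h : 'I_n -> A) i : mmap f h 'X_i = h i.
Proof. by rewrite mmapX mmap1U. Qed.

Lemma var_neq0 (n : nat) (K : nzRingType) (i : 'I_n) : 'X_i != 0 :> {mpoly K[n]}.
Proof.
apply/eqP => /(congr1 (mcoeff U_(i))) /eqP.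
by rewrite mcoeffX eqxx mcoeff0 oner_eq0.
Qed.

Section Variables.
Variables (K : fieldType) (m : nat).
Local Notation A := {mpoly K[m]}.

(** Substituting 0 for the variables outside [js] gives primes that grow as [js]
    shrinks, from the zero ideal up to the ideal of all variables. *)
Definition keep (js : seq 'I_m) (i : 'I_m) : A :=
  if i \in js then 'X_i else 0.

Local Notation keep_map js := (mmap (@mpolyC m K) (keep js)).

Lemma keep_mapK (js js' : seq 'I_m) (p : A) : {subset js <= js'} ->
  keep_map js (keep_map js' p) = keep_map js p.
Proof.
move=> sub; apply: mmap_comp => [c|i] /=; first exact: mmapC.
rewrite [keep js' i]/keep; have [_|njs'] := boolP (i \in js').
  by rewrite mmap_var.
by rewrite rmorph0 /keep ifN //; apply: contra njs' => /sub.
Qed.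

(** The variable [X_j] separates two consecutive primes of that chain, so it can
    be added to the independent family; at the top only constants remain. *)
Lemma variables_independent_mod_keep (js : seq 'I_m) : uniq js ->
  independent_mod (@mpolyC m K) (kernel (keep_map js)) [seq 'X_j | j <- js].
Proof.
elim: js => [_ N c [e [/= /size0nil-> _ nz]]|j js IH /= /andP[njs uniq_js]].
  by rewrite /kernel /= mmapC => /eqP; rewrite mpolyC_eq0 (negbTE nz).
apply: (independent_mod_cons _ _ _ _ _ (IH uniq_js)).
- exact: kernel_prime.
- exact: kernel_prime.
- move=> p; rewrite /kernel /= => p0.
  rewrite -(@keep_mapK js (j :: js)) ?p0 ?rmorph0 // => i js_i.
  by rewrite inE js_i orbT.
- by rewrite /kernel /= mmap_var /keep (negbTE njs).
- rewrite /kernel /= mmap_var /keep mem_head; apply/eqP; exact: var_neq0.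
Qed.

Lemma variables_independent :
  independent_mod (@mpolyC m K) [set 0]%classic [seq 'X_j | j <- enum 'I_m].
Proof.
move=> N c nt /= s0.
have /= := variables_independent_mod_keep (enum_uniq 'I_m) nt.
by apply; rewrite /kernel /= s0 rmorph0.
Qed.

End Variables.

Section CremonaPrime.
Variables (K : fieldType) (m d : nat) (W : 'M[K]_(m, d)).
Hypothesis W_neq0 : forall i, col i W != 0.
Local Notation S := {mpoly K[m]}.
Local Notation F := {fraction S}.
Local Notation frac := (@tofrac S).

Definition const_frac : {rmorphism K -> F} := (frac \o @mpolyC m K).

(** The [i]-th coordinate of a generic point of the row space of [W], with
    parameters the inverses of the variables: then the variables themselves are
    values of [cremona], provided [W] contains an identity matrix. *)
Definition param_form (i : 'I_d) : F :=
  \sum_j const_frac (W j i) * (frac 'X_j)^-1.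

(** Comorphism of the parametrisation that takes a generic point of the row space
    of [W] to its coordinatewise inverse; its kernel is the ideal of the closure
    of the inverted linear space. *)
Definition cremona : {mpoly K[d]} -> F :=
  mmap const_frac (fun i => (param_form i)^-1).

HB.instance Definition _ := GRing.RMorphism.on cremona.

Lemma frac_var_neq0 j : frac 'X_j != 0.
Proof. by rewrite tofrac_eq0 var_neq0. Qed.

Lemma param_form_neq0 i : param_form i != 0.
Proof.
apply: contra (W_neq0 i) => /eqP form0; apply/eqP/colP => j; rewrite !mxE.
(* Clearing denominators and setting X_j = 0 isolates the entry W j i. *)
have /eqP : frac (\sum_l (W l i)%:MP * \prod_(k | k != l) 'X_k) = 0.
  transitivity (param_form i * \prod_k frac 'X_k); last by rewrite form0 mul0r.
  rewrite rmorph_sum mulr_suml; apply: eq_bigr => l _ /=.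
  rewrite rmorphM rmorph_prod /= -mulrA; congr (_ * _).
  by rewrite [in RHS](bigD1 l) //= mulKf // frac_var_neq0.
rewrite tofrac_eq0 => /eqP/(congr1 (meval (fun k => (k != j)%:R))).
rewrite rmorph0 rmorph_sum /= (bigD1 j) //=.
rewrite [X in _ + X]big1 ?addr0.
  rewrite rmorphM /= mevalC rmorph_prod /= big1 ?mulr1 // => k kj.
  by rewrite mevalXU kj.
move=> l lj; rewrite rmorphM rmorph_prod /= (bigD1 j) 1?eq_sym //=.
by rewrite mevalXU eqxx mul0r mulr0.
Qed.

Lemma cremona_var i : cremona 'X_i = (param_form i)^-1.
Proof. by rewrite /cremona mmap_var. Qed.

(** The columns selected by [f] form an identity matrix, so [cremona] sends these
    coordinates to the parameters, which are independent: the quotient by the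
    kernel has transcendence degree at least [m]. *)
Lemma cremona_independent (f : 'I_m -> 'I_d) :
    (forall i j, W j (f i) = (j == i)%:R) ->
  independent_mod (@mpolyC d K) (kernel cremona) [seq 'X_(f j) | j <- enum 'I_m].
Proof.
move=> Wf N c; rewrite size_map => nt; rewrite /kernel /=.
rewrite (@box_sum_map _ _ _ _ _ const_frac) => [|a /=]; last exact: mmapC.
have -> : [seq cremona i | i <- [seq 'X_(f j) | j <- enum 'I_m]]
    = [seq frac i | i <- [seq 'X_j | j <- enum 'I_m]].
  rewrite -!map_comp; apply: eq_map => j /=; rewrite cremona_var /param_form.
  rewrite (bigD1 j) //= Wf eqxx rmorph1 mul1r big1 ?addr0 ?invrK //.
  by move=> k kj; rewrite Wf (negbTE kj) rmorph0 mul0r.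
rewrite -(@box_sum_map _ _ _ (@mpolyC m K)) => [/eqP|a //].
rewrite tofrac_eq0 => /eqP; apply: variables_independent.
by rewrite size_map.
Qed.

(** Up to the product of all [y_i] with [i] in [L], the generator is the relation
    evaluated at the inverses [1 / y_i], that is, at a point of the row space. *)
Lemma cremona_OT_generator (L : {set 'I_d}) (c : 'I_d -> K) :
    (forall j, \sum_(i in L) c i * W j i = 0) ->
  cremona (OT_generator L c) = 0.
Proof.
move=> cW.
have -> : cremona (OT_generator L c)
    = (\prod_(i in L) param_form i)^-1
      * \sum_(i in L) const_frac (c i) * param_form i.
  rewrite mulr_sumr rmorph_sum; apply: eq_bigr => i Li.
  rewrite -mul_mpolyC rmorphM /= [cremona _%:MP]mmapC rmorph_prod mulrCA.
  congr (_ * _); rewrite [in RHS](big_setD1 i) //= invfM mulrAC.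
  rewrite mulVf ?mul1r ?param_form_neq0 //.
  by rewrite -prodfV; apply: eq_bigr => j _; apply: cremona_var.
have -> : \sum_(i in L) const_frac (c i) * param_form i = 0; last by rewrite mulr0.
transitivity (\sum_j const_frac (\sum_(i in L) c i * W j i) * (frac 'X_j)^-1).
  under eq_bigr do rewrite mulr_sumr; rewrite exchange_big; apply: eq_bigr => j _.
  rewrite rmorph_sum mulr_suml; apply: eq_bigr => i _.
  by rewrite rmorphM mulrA.
by rewrite big1 // => j _; rewrite cW rmorph0 mul0r.
Qed.

End CremonaPrime.

(** * Quadratic elements of the Orlik-Terao ideal *)

Section QuadraticPart.
Variables (K : fieldType) (d : nat).
Local Notation A := {mpoly K[d]}.

Lemma OT_generator_homog (L : {set 'I_d}) (c : 'I_d -> K) :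
  OT_generator L c \is (#|L|.-1).-homog.
Proof.
apply: rpred_sum => i Li; apply: rpredZ; rewrite mprodXE dhomogX /=.
rewrite mdeg_sum (eq_bigr (fun=> 1%N)) => [|j _]; last by rewrite mdeg1.
by rewrite sum1_card (cardsD1 i L) Li.
Qed.

(** Taking the part of degree [e] discards the generators of larger degree and
    leaves multiples of those of degree [e], which [phi] kills. *)
Lemma homog_in_kernel (B : idomainType) (phi : {rmorphism A -> B}) (e : nat)
    (s : seq (A * A)) :
    (forall u, u \in s -> exists2 k, u.2 \is k.-homog &
        (e < k)%N \/ k = e /\ phi u.2 = 0) ->
    \sum_(u <- s) u.1 * u.2 \is e.-homog ->
  phi (\sum_(u <- s) u.1 * u.2) = 0.
Proof.
move=> s_hom /pihomog_dE <-; rewrite !linear_sum rmorph_sum big_seq big1 //.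
move=> -[a f] /s_hom [k /= f_hom f_phi]; rewrite (mpolyE a) mulr_suml.
rewrite linear_sum rmorph_sum big1 //= => m _.
have hom : a@_m *: 'X_[m] * f \is (mdeg m + k).-homog.
  by apply: dhomogM f_hom; apply: rpredZ; rewrite dhomogX.
have [mk_e|mk_e] := eqVneq (mdeg m + k)%N e.
  rewrite pihomog_dE -?mk_e // rmorphM.
  case: f_phi => [|[_ ->]]; last by rewrite mulr0.
  by rewrite -mk_e ltnNge leq_addl.
by rewrite (pihomog_ne0 mk_e) ?rmorph0.
Qed.

End QuadraticPart.

Section ShortRelations.
Variables (K : fieldType) (n d : nat) (alpha : 'I_d -> linear_form K n).
Hypothesis arr : arrangement alpha.

Lemma relation_spaceP (c : 'rV[K]_d) :
  reflect (\sum_i c 0 i *: alpha i = 0) (c \in relation_space alpha).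
Proof. by rewrite memv_ker lfunE; apply: eqP. Qed.

(** A relation between one or two forms would make a form zero or two hyperplanes
    equal. *)
Lemma relation_weight (c : 'rV[K]_d) :
  c \in relation_space alpha -> c != 0 -> (3 <= weight c)%N.
Proof.
case: arr => alpha0 inj_alpha /relation_spaceP rel /rV0Pn[i nz_i].
rewrite ltnNge; apply/negP => le2.
have supp_i : i \in [pred k | c 0 k != 0] by [].
have [j /andP[ji _] supp_ij] : exists2 j, (j != i) && (c 0 j != 0)
    & forall k, k != i -> k != j -> c 0 k = 0.
  have [/existsP[j jP]|] := boolP [exists j, (j != i) && (c 0 j != 0)].
    exists j => // k ki kj; apply/eqP; rewrite -[_ == _]negbK; apply/negP => nzk.
    move: le2; rewrite leqNgt /weight => /negP; apply.
    rewrite (cardD1 i) supp_i (cardD1 j) !inE jP (cardD1 k) !inE kj ki nzk.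
    by [].
  move=> /existsPn nex; move: rel; rewrite (bigD1 i) //= big1 ?addr0.
    move/eqP; rewrite scaler_eq0 (negbTE nz_i) (negbTE (alpha0 i)) //.
  move=> k ki; have := nex k; rewrite ki negbK /= => /eqP ->.
  by rewrite scale0r.
have alpha_ij : alpha i = (- (c 0 i)^-1 * c 0 j) *: alpha j.
  apply: (scalerI nz_i); rewrite scalerA mulrA mulrN mulfV // mulN1r scaleNr.
  apply/eqP; rewrite -addr_eq0 -[X in _ == X]rel (bigD1 i) //= (bigD1 j) //=.
  by rewrite big1 ?addr0 // => k /andP[ki kj]; rewrite supp_ij ?scale0r.
set a := (X in X *: _) in alpha_ij.
have nza : a != 0.
  by apply: contraNneq (alpha0 i) => a0; rewrite alpha_ij a0 scale0r.
move/eqP: ji; apply; apply: inj_alpha; apply/vspaceP => v.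
by rewrite !memv_ker alpha_ij scale_lfunE scaler_eq0 (negbTE nza).
Qed.

Lemma dependency_relation (L : {set 'I_d}) (c : 'I_d -> K)
    (r := \row_i (if i \in L then c i else 0)) :
  dependency alpha L c ->
  [/\ r \in relation_space alpha, (3 <= #|L|)%N & #|L| = 3%N -> weight r = 3%N].
Proof.
case=> rel [i Li nz_i].
have r_rel : r \in relation_space alpha.
  apply/relation_spaceP; rewrite -[RHS]rel [RHS]big_mkcond.
  by apply: eq_bigr => j _; rewrite mxE; case: ifP => // _; rewrite scale0r.
have ler : (weight r <= #|L|)%N.
  apply/subset_leq_card/fintype.subsetP => j; rewrite inE mxE.
  by case: ifP => // _; rewrite eqxx.
have ge3 : (3 <= weight r)%N.
  apply: relation_weight r_rel _; apply/rV0Pn; exists i.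
  by rewrite mxE Li.
split=> // [|L3]; first exact: leq_trans ge3 ler.
by apply/eqP; rewrite eqn_leq ge3 -L3 ler.
Qed.

(** A generator attached to [L] has degree [#|L| - 1], and dependent sets have at
    least three elements; the quadratic part therefore comes from the relations of
    weight three, which vanish on the row space of [W]. *)
Lemma OT_quadratic_ideal_cremona (m : nat) (W : 'M[K]_(m, d)) :
    (forall i, col i W != 0) ->
    (forall c : 'rV[K]_d, c \in relation_space alpha -> weight c = 3%N ->
       c *m W^T = 0) ->
  (OT_quadratic_ideal alpha `<=` kernel (cremona W))%classic.
Proof.
move=> W0 W_rel p [s [s_quad ->]]; rewrite /kernel /= rmorph_sum big_seq big1 //.
move=> u /s_quad[[t [t_gen u2E]] u2_hom]; rewrite rmorphM /=.
suff -> : cremona W u.2 = 0; first by rewrite mulr0.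
rewrite u2E; apply: (@homog_in_kernel _ _ _ _ 2); last by rewrite -u2E.
move=> v /t_gen[L [c [_ dep ->]]]; exists #|L|.-1; first exact: OT_generator_homog.
have [r_rel ge3 wt3] := dependency_relation dep.
have [L3|L3] := eqVneq #|L| 3; [right|left]; last first.
  by rewrite -subn1 ltn_subRL ltn_neqAle eq_sym L3.
split; first by rewrite L3.
apply: cremona_OT_generator => // j.
have /rowP/(_ j) := W_rel _ r_rel (wt3 L3); rewrite !mxE => rj.
rewrite -[RHS]rj [LHS]big_mkcond; apply: eq_bigr => i _; rewrite !mxE.
by case: ifP => // _; rewrite mul0r.
Qed.

End ShortRelations.

(** * Comparison of the relation spaces *)

(** The orthogonal of the rows of [S], in a basis that is an identity matrix on the
    columns selected by [f]. *)
Lemma normalized_kernel (K : fieldType) (p d : nat) (S : 'M[K]_(p, d)) :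
  exists m (W : 'M[K]_(m, d)) (f : 'I_m -> 'I_d),
    [/\ (m + \rank S)%N = d, W *m S^T = 0,
        forall q (B : 'M[K]_(q, d)), B *m S^T = 0 -> (B <= W)%MS
      & forall i j, W j (f i) = (j == i)%:R].
Proof.
pose V := row_base (kermx S^T).
have V_full : row_full V^T.
  by rewrite -[row_full _]/(\rank _ == _) mxrank_tr; apply: row_base_free.
pose f := fullrankfun V_full; pose U := rowsub f V^T.
have U_unit : U^T \in unitmx by rewrite unitmx_tr fullrowsub_unit.
exists (\rank (kermx S^T)), (invmx U^T *m V), f; split.
- by rewrite mxrank_ker mxrank_tr subnK ?rank_leq_col.
- apply/sub_kermxP; apply: submx_trans (submxMl _ _) _.
  by rewrite eq_row_base.
- move=> q B BS0; rewrite eqmxMfull ?row_full_unit ?unitmx_inv //.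
  by rewrite eq_row_base; apply/sub_kermxP.
move=> i j; have /matrixP/(_ j i) := mulVmx U_unit.
rewrite [RHS]mxE => <-; rewrite !mxE; apply: eq_bigr => k _.
by rewrite !mxE.
Qed.

Section TwoFormal.
Variables (K : fieldType) (n d : nat) (alpha : 'I_d -> linear_form K n).

Definition coef_mx : 'M[K]_(d, n) := \matrix_(i, j) alpha i (delta_mx j 0).

Lemma coef_mxE i v : alpha i v = (coef_mx *m v) i 0.
Proof.
rewrite {1}[v]matrix_sum_delta linear_sum mxE; apply: eq_bigr => j _.
by rewrite big_ord1 linearZ mxE mulrC.
Qed.

Lemma relation_coef_mx (c : 'rV[K]_d) :
  (c \in relation_space alpha) = (c *m coef_mx == 0).
Proof.
have relE v : (\sum_i c 0 i *: alpha i) v = (c *m (coef_mx *m v)) 0 0.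
  rewrite sum_lfunE [RHS]mxE; apply: eq_bigr => i _.
  by rewrite scale_lfunE coef_mxE.
apply/relation_spaceP/eqP => rel0.
  apply/rowP => j; have := relE (delta_mx j 0).
  by rewrite rel0 lfunE /= mulmxA -colE !mxE => <-.
by apply/lfunP => v; rewrite relE mulmxA rel0 mul0mx mxE lfunE.
Qed.

(** A vector in the kernel of the coefficient matrix lies on every hyperplane. *)
Lemma essential_rank : essential alpha -> \rank coef_mx = n.
Proof.
move=> ess; rewrite -mxrank_tr; apply/eqP.
rewrite -[_ == _]/(row_free _) -kermx_eq0; apply/eqP/row_matrixP => i.
set v := row i _; rewrite row0; apply: (can_inj (@trmxK _ _ _)).
have : v *m coef_mx^T = 0 by apply/sub_kermxP; apply: row_sub.
move/(congr1 trmx); rewrite trmx_mul trmxK trmx0 => v0.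
have : v^T \in flat alpha [set: 'I_d].
  rewrite /flat; elim/big_rec: _ => [|j U _ vU]; first exact: memvf.
  by rewrite memv_cap vU andbT memv_ker coef_mxE v0 mxE.
by rewrite ess memv0 trmx0 => /eqP.
Qed.

Definition short_relations p (S : 'M[K]_(p, d)) : Prop :=
  forall i, row i S \in relation_space alpha /\ weight (row i S) = 3%N.

(** The weight-three relations need not form a finite set, but the rows of a
    matrix of such relations of maximal rank span all of them. *)
Lemma maximal_short_relations : exists p (S : 'M[K]_(p, d)),
  short_relations S /\ forall c : 'rV[K]_d,
    c \in relation_space alpha -> weight c = 3%N -> (c <= S)%MS.
Proof.
pose P r := `[< exists p (S : 'M[K]_(p, d)), short_relations S /\ \rank S = r >].
have exP : exists r, P r.
  by exists 0%N; apply/asboolP; exists 0%N, 0; split; [case|rewrite mxrank0].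
have leP r : P r -> (r <= d)%N.
  by move=> /asboolP[p [S [_ <-]]]; apply: rank_leq_col.
case: (ex_maxnP exP leP) => r /asboolP[p [S [S_short rS]]] r_max.
exists p, S; split=> // c c_rel c_wt.
have : (\rank (col_mx c S) <= r)%N.
  apply: r_max; apply/asboolP; exists (1 + p)%N, (col_mx c S); split=> // i.
  case: (split_ordP i) => k ->; last by rewrite rowKd.
  by rewrite rowKu row_id.
rewrite -addsmxE -rS => le_rS.
have := mxrank_leqif_sup (addsmxSr c S); case=> le_Sr.
rewrite eqn_leq le_Sr le_rS => /esym; apply: submx_trans; exact: addsmxSl.
Qed.

(** The rows of [S] lie in the relation space, which has dimension [d - n] because
    the arrangement is essential; by the bound on the rank they span it. *)
Lemma two_formal_of_rank p (S : 'M[K]_(p, d)) :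
    essential alpha -> short_relations S -> (d - n <= \rank S)%N ->
  two_formal alpha.
Proof.
move=> ess S_short le_rank.
exists [seq row i S | i <- enum 'I_p]; split.
  by move=> _ /mapP[i _ ->]; apply: S_short.
apply/eqP; rewrite eqEsubv; apply/andP; split.
  by apply/span_subvP => _ /mapP[i _ ->]; case: (S_short i).
have kerS : (kermx coef_mx <= S)%MS.
  have S_ker : (S <= kermx coef_mx)%MS.
    apply/row_subP => i; apply/sub_kermxP/eqP.
    by rewrite -relation_coef_mx; case: (S_short i).
  have [le_SK <-] := mxrank_leqif_sup S_ker.
  by rewrite eqn_leq le_SK mxrank_ker essential_rank.
apply/subvP => c; rewrite relation_coef_mx => /eqP/sub_kermxP c_ker.
have /submxP[D ->] := submx_trans c_ker kerS.
rewrite mulmx_sum_row; apply: memv_suml => i _; apply/memvZ/memv_span.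
by apply: map_f; rewrite mem_enum.
Qed.

End TwoFormal.

(** The prime used is the kernel of [cremona W], for [W] the orthogonal of the
    weight-three relations.  Its height is at most [d - m], where [m] is the
    dimension of this orthogonal, and [d - m] is the rank of these relations. *)
Lemma two_formal_of_height (K : fieldType) (n d : nat)
    (alpha : 'I_d -> linear_form K n) :
  arrangement alpha -> essential alpha ->
  has_height (OT_quadratic_ideal alpha) (d - n)%N -> two_formal alpha.
Proof.
move=> arr ess [_ chains].
have [p [S [S_short S_max]]] := maximal_short_relations alpha.
apply: (two_formal_of_rank ess S_short).
have [m [W [f [m_rank WS W_max Wf]]]] := normalized_kernel S.
have alphaW : ((coef_mx alpha)^T <= W)%MS.
  apply: W_max; apply: (can_inj (@trmxK _ _ _)).
  rewrite trmx_mul !trmxK trmx0; apply/row_matrixP => i.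
  rewrite row_mul row0; apply/eqP; rewrite -relation_coef_mx.
  by case: (S_short i).
(* W contains the coordinate vectors of the forms, and no form is zero. *)
have W_neq0 i : col i W != 0.
  have [alpha0 _] := arr; apply: contra (alpha0 i) => /eqP Wi0.
  apply/eqP/lfunP => v; rewrite lfunE coef_mxE.
  have /submxP[D /(congr1 trmx)] := alphaW; rewrite trmxK => ->.
  transitivity (row i ((D *m W)^T *m v) 0 0); first by rewrite [RHS]mxE.
  rewrite row_mul; have -> : row i (D *m W)^T = 0.
    by rewrite -tr_col colE -mulmxA -colE Wi0 mulmx0 trmx0.
  by rewrite mul0mx mxE.
have W_rel (c : 'rV_d) : c \in relation_space alpha -> weight c = 3%N ->
    c *m W^T = 0.
  move=> c_rel c_wt; have /submxP[D ->] := S_max c c_rel c_wt.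
  by rewrite -mulmxA -[S *m _]trmxK trmx_mul trmxK WS trmx0 mulmx0.
have chainP := chains _ (kernel_prime (cremona W))
  (OT_quadratic_ideal_cremona arr W_neq0 W_rel).
have := prime_chain_bound chainP (cremona_independent Wf).
by rewrite size_map size_enum_ord addnC -[X in (_ <= X)%N]m_rank leq_add2l.
Qed.

Theorem corollary2p4 (R : realType) (n d : nat)
    (alpha : 'I_d -> linear_form R[i] n) :
  arrangement alpha ->
  essential alpha ->
  has_height (OT_quadratic_ideal alpha) (d - n)%N ->
  two_formal alpha.
Proof. exact: two_formal_of_height. Qed.
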